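(* Suppose there exist constants $c_0,C_0>0$ such that for all $h>0$, all $y\in\mathbb R^d$ and $\mathbb P_a$-a.e. $Y^a$, $\kappa_{h,\theta_0}(y;Y^a)\le C_0\det\{G_h(Y^a)\}^{1/2}\exp[-c_0\|y-m_h(Y^a)\|^2_{G_h(Y^a)}]$, and let $C=C_0^2(\pi/(2c_0))^{d/2}$. (a) Assume there exist $h_r>0$, a function $r(h)\ge0$ and $C_r<\infty$ with $\mathbb E[\det\{G_h(Y^a)\}^{1/2}]\le C_rh^{-r(h)}$ for all $0<h\le h_r$. Then for every measurable $\mathcal Y_0\subseteq\mathbb R^d$ and $0<h\le h_r$, $h<1$: $H_h(\mathcal Y_0)\le H_h(\mathbb R^d)\le CC_rh^{-r(h)}$ and $$d_{\mathrm{eff}}(h;\mathcal Y_0)\le r(h)+\frac{\log(CC_r\vee1)}{\log(1/h)}.$$ If moreover $\limsup_{h\downarrow0}r(h)\le r_\star$, then $d_{\mathrm{eff}}(h;\mathcal Y_0)\le r_\star+o(1)$ as $h\downarrow0$. (b) Suppose instead that for some integer $d_\star\le d$ there are constants $0<c_1\le c_2<\infty$ and $h_0>0$ such that, $\mathbb P_a$-almost surely, for every $0<h\le h_0$ the eigenvalues $\lambda_1\le\dots\le\lambda_d$ (suitably ordered) of $\Sigma_h(Y^a)=G_h(Y^a)^{-1}$ satisfy $c_1h^2\le\lambda_j\le c_2h^2$ for $j\le d_\star$ and $c_1\le\lambda_j\le c_2$ for $j>d_\star$. Then for every measurable $\mathcal Y_0\subseteq\mathbb R^d$, $H_h(\mathcal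 Y_0)\le H_h(\mathbb R^d)\lesssim h^{-d_\star}$ and $d_{\mathrm{eff}}(h;\mathcal Y_0)\le d_\star+o(1)$ as $h\downarrow0$. If in addition there exist $c_\ell>0$, $h_0'>0$ with $\int_{\mathbb R^d}\kappa_{h,\theta_0}(u;Y^a)^2du\ge c_\ell\det\{G_h(Y^a)\}^{1/2}$ $\mathbb P_a$-a.s. for all $0<h\le h_0'$, then $d_{\mathrm{eff}}(h;\mathbb R^d)=d_\star+o(1)$ as $h\downarrow0$.
   Context: $Y^a$ is a random vector in $\mathbb R^d$ with law $\mathbb P_a$. For each $h>0$ and $u\in\mathbb R^d$, $\kappa_{h,\theta_0}(\cdot;u)\ge0$ is a probability density on $\mathbb R^d$ with finite mean $m_h(u)=\int v\,\kappa_{h,\theta_0}(v;u)dv$ and invertible covariance $\Sigma_h(u)=\int\{v-m_h(u)\}\{v-m_h(u)\}^\top\kappa_{h,\theta_0}(v;u)dv$; $G_h(u)=\Sigma_h(u)^{-1}$ and $\|v\|_G=(v^\top Gv)^{1/2}$. For measurable $\mathcal Y_0\subseteq\mathbb R^d$: $H_h(\mathcal Y_0)=\mathbb E[\int_{\mathcal Y_0}\kappa_{h,\theta_0}(y;Y^a)^2dy]$ and, for $0<h<1$, $d_{\mathrm{eff}}(h;\mathcal Y_0)=\log\{H_h(\mathcal Y_0)\vee1\}/\log(1/h)$. *)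

(* Defs.v *)
From HB Require Import structures.
From mathcomp Require Import all_boot all_order all_algebra.
From mathcomp Require Import all_classical all_reals all_analysis.
Set Implicit Arguments. Unset Strict Implicit. Unset Printing Implicit Defensive.
Import Order.TTheory GRing.Theory Num.Theory.
Import numFieldNormedType.Exports.
Local Open Scope classical_set_scope.
Local Open Scope ring_scope.

Section kernel_defs.
Variables (R : realType) (d : nat).
Variable leb : {measure set (d.-tuple R) -> \bar R}.
Variable P : probability (d.-tuple R) R.

Definition vec (v : d.-tuple R) : 'cV[R]_d := \col_i tnth v i.

Definition kmean (k : d.-tuple R -> R) : 'cV[R]_d :=
  \col_i Rintegral leb setT (fun v => tnth v i * k v).

Definition kcov (k : d.-tuple R -> R) : 'M[R]_d :=
  \matrix_(i, j) Rintegral leb setT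
     (fun v => (tnth v i - kmean k i 0) * (tnth v j - kmean k j 0) * k v).

Definition kprec (k : d.-tuple R -> R) : 'M[R]_d := invmx (kcov k).

Definition qform (G : 'M[R]_d) (x : 'cV[R]_d) : R := (x^T *m G *m x) 0 0.

(* H_h(Y0) = E[ int_{Y0} kappa_h(y; Y)^2 dy ], where kh u y = kappa_h(y; u)
   and the expectation is over the law P of Y^a *)
Definition Hh (kh : d.-tuple R -> d.-tuple R -> R) (Y0 : set (d.-tuple R)) : \bar R :=
  (\int[P]_u \int[leb]_(y in Y0) ((kh u y) ^+ 2)%:E)%E.

Definition deff (kh : d.-tuple R -> d.-tuple R -> R) (h : R) (Y0 : set (d.-tuple R)) : \bar R :=
  match Hh kh Y0 with
  | r%:E => (ln (Num.max r 1) / ln (1 / h))%:E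
  | +oo%E => +oo%E
  | -oo%E => 0%E
  end.

End kernel_defs.

(* Main.v *)
(* Squaring the Gaussian envelope and integrating over R^d gives
   int kappa_h(y; u)^2 dy <= C (det G_h(u))^(1/2), so H_h(R^d) is at most C times
   the expectation of (det G_h)^(1/2); the rest is taking logarithms.
   The Gaussian integral with a positive definite matrix is computed by
   induction on the dimension: Tonelli in the first coordinate and completion
   of the square turn the matrix into its Schur complement, so that no linear
   change of variables is needed.  The measure leb, known only on closed boxes,
   coincides with the iterated Lebesgue measure because boxes form a covering
   pi-system that generates the product sigma-algebra. *)
Require Import Defs.
From HB Require Import structures.
From mathcomp Require Import all_boot all_order all_algebra.
From mathcomp Require Import all_classical all_reals all_analysis.
From mathcomp Require Import measurable_realfun ring.
Import Order.TTheory GRing.Theory Num.Theory.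
Import numFieldNormedType.Exports.
Local Open Scope classical_set_scope.
Local Open Scope ring_scope.
Set Implicit Arguments. Unset Strict Implicit. Unset Printing Implicit Defensive.

(** * Closed boxes: a covering pi-system that generates the product sigma-algebra *)

Section boxes.
Context {R : realType}.

Definition box (d : nat) (a b : d.-tuple R) : set (d.-tuple R) :=
  [set x | forall i, tnth a i <= tnth x i <= tnth b i].

Lemma measurable_box d (a b : d.-tuple R) : measurable (box a b).
Proof.
have -> : box a b =
    \bigcap_(i in [set: 'I_d]) ((fun x => tnth x i) @^-1` `[tnth a i, tnth b i]).
  apply/seteqP; split => [x abx i _|x abx i]; first by rewrite /= in_itv/= abx.
  by have := abx i I; rewrite /= in_itv.
apply: fin_bigcap_measurable => [|i _]; first exact: finite_finset.
rewrite -[X in measurable X]setTI.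
by apply: measurable_tnth => //; exact: measurable_itv.
Qed.

(** No order between the corners [a] and [b] is imposed, so disjoint boxes still intersect in a
    member of the family. *)
Definition boxes (d : nat) : set (set (d.-tuple R)) :=
  [set A | exists a b, A = box a b].
Arguments boxes : clear implicits.

Lemma boxes_setI d : setI_closed (boxes d).
Proof.
move=> _ _ [a [b ->]] [a' [b' ->]].
exists [tuple Num.max (tnth a i) (tnth a' i) | i < d],
       [tuple Num.min (tnth b i) (tnth b' i) | i < d].
apply/seteqP; split => [x [ab ab'] i|x abx].
  rewrite !tnth_mktuple ge_max le_min.
  by have /andP[-> ->] := ab i; have /andP[-> ->] := ab' i.
by split => i; have := abx i; rewrite !tnth_mktuple ge_max le_min;
  case/andP => /andP[] ? ? /andP[] ? ?; apply/andP.
Qed.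

Lemma box_cover d (x : d.-tuple R) : exists n : nat, forall i,
  - n%:R <= tnth x i <= n%:R.
Proof.
exists (Num.truncn (\sum_i `|tnth x i|)).+1 => i; rewrite -ler_norml.
have : `|tnth x i| <= \sum_i `|tnth x i|.
  by rewrite (bigD1 i)//= lerDl sumr_ge0.
by move=> /le_trans; apply; exact/ltW/truncnS_gt.
Qed.

(** For each coordinate, the sets [B] of reals whose preimage lies in the sigma-algebra generated by
    boxes form a sigma-algebra [S]. It therefore suffices that [S] contains the closed half-lines
    unbounded above. *)
Lemma measurable_boxesE d :
  (@measurable _ (d.-tuple R)) = <<s boxes d >>.
Proof.
apply/seteqP; split; last first.
  apply: smallest_sub; first exact: sigma_algebra_measurable.
  by move=> _ [a [b ->]]; exact: measurable_box.
apply: smallest_sub; first exact: smallest_sigma_algebra.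
rewrite -bigcup_seq; apply: bigcup_sub => /= i _ _ [B mB <-].
pose S : set (set R) := [set B | <<s boxes d >> (setT `&` (fun x => tnth x i) @^-1` B)].
rewrite -[_ (_ `&` _)]/(S B).
have Ssig : sigma_algebra setT S.
  split.
  - by rewrite /S /= preimage_set0 setI0; exact: sigma_algebra0.
  - move=> A; rewrite /S /= !setTI setTD => h.
    by rewrite preimage_setC; exact: sigma_algebraC.
  - move=> F h; rewrite /S /= setTI preimage_bigcup.
    by apply: sigma_algebra_bigcup => n; have := h n; rewrite /S/= setTI.
have mS : (@measurable _ R) `<=` S.
  rewrite [X in X `<=` _](_ : _ = (<<s @RGenCInfty.G R >>)%classic).
    apply: smallest_sub => // _ [x ->]; rewrite /S /=.
    (* A half-space bounded below by [x] in coordinate [i] is a countable union of boxes; those with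
       [n] smaller than [x] are empty and do no harm. *)
    rewrite [X in <<s _ >> X](_ : _ = \bigcup_(n : nat)
      box [tuple if j == i then x else - n%:R | j < d] [tuple n%:R | j < d]).
      by apply: sigma_algebra_bigcup => n; apply: sub_sigma_algebra;
         eexists; eexists.
    apply/seteqP; split => [y [_ /=]|y [n _ yn]].
      rewrite in_itv/= andbT => xy; have [n yn] := box_cover y.
      exists n => // j; rewrite !tnth_mktuple; case: eqP => [->|_].
        by rewrite xy; case/andP: (yn i).
      exact: yn.
    split => //=; rewrite in_itv/= andbT.
    by have := yn i; rewrite !tnth_mktuple eqxx => /andP[].
  exact: RGenCInfty.measurableE.
exact: mS.
Qed.

Lemma box_measure_unique d (m1 m2 : {measure set (d.-tuple R) -> \bar R}) :
  (forall a b : d.-tuple R, (forall i, tnth a i <= tnth b i) ->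
     m1 (box a b) = (\prod_(i < d) (tnth b i - tnth a i))%:E) ->
  (forall a b : d.-tuple R, (forall i, tnth a i <= tnth b i) ->
     m2 (box a b) = (\prod_(i < d) (tnth b i - tnth a i))%:E) ->
  forall A, measurable A -> m1 A = m2 A.
Proof.
move=> m1E m2E.
apply: (measure_unique (boxes d)
  (fun n => box [tuple - n%:R | j < d] [tuple n%:R | j < d])).
- exact: measurable_boxesE.
- exact: boxes_setI.
- by move=> n; eexists; eexists.
- apply/seteqP; split => // x _; have [n xn] := box_cover x.
  by exists n => // i; rewrite !tnth_mktuple.
- move=> _ [a [b ->]].
  have [ab|] := pselect (forall i, tnth a i <= tnth b i).
    by rewrite m1E// m2E.
  (* The volume formula is assumed for ordered corners only; a box with a reversed side is empty. *)
  move=> /existsNP[i /negP nab].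
  suff -> : box a b = set0 by rewrite !measure0.
  apply/seteqP; split => // x /(_ i) /andP[ax xb].
  by move: nab; rewrite (le_trans ax xb).
- move=> n; rewrite m1E ?ltry// => i.
  by rewrite !tnth_mktuple (@le_trans _ _ 0)// oppr_le0.
Qed.

(** * Adding one coordinate to a measure on tuples *)

Definition tcons d (p : R * d.-tuple R) : d.+1.-tuple R :=
  [the d.+1.-tuple R of p.1 :: p.2].

Definition tuncons d (t : d.+1.-tuple R) : R * d.-tuple R :=
  (thead t, [tuple of behead t]).

Lemma tconsK d : cancel (@tcons d) (@tuncons d).
Proof.
by move=> [x t]; rewrite /tuncons /tcons theadE; congr pair; exact: val_inj.
Qed.

Lemma measurable_tcons d :
  measurable_fun [set: (measurableTypeR R * d.-tuple R)%type] (@tcons d).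
Proof. exact: measurable_cons. Qed.

Lemma measurable_tuncons d :
  measurable_fun [set: d.+1.-tuple R] (@tuncons d).
Proof.
apply: measurable_fun_pair; last exact: measurable_behead.
exact: measurable_tnth.
Qed.

Section cons_measure.
Variables (d : nat) (mu : {sigma_finite_measure set (d.-tuple R) -> \bar R}).

Definition cons_measure : set (d.+1.-tuple R) -> \bar R :=
  pushforward (@lebesgue_measure R \x mu)%E (@tcons d).

Let cons_measure0 : cons_measure set0 = 0%E.
Proof. by rewrite /cons_measure /pushforward preimage_set0 measure0. Qed.

Let cons_measure_ge0 A : (0 <= cons_measure A)%E.
Proof. exact: (measure_ge0 (@lebesgue_measure R \x mu)%E). Qed.

Let cons_measure_sigma_additive : semi_sigma_additive cons_measure.
Proof.
move=> F mF tF mUF; rewrite /cons_measure /pushforward preimage_bigcup.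
apply: measure_semi_sigma_additive.
- by move=> n; rewrite -[X in measurable X]setTI; exact: measurable_tcons.
- apply/trivIsetP => /= i j _ _ ij; rewrite -preimage_setI.
  by move/trivIsetP : tF => /(_ i j I I ij) ->; rewrite preimage_set0.
- by rewrite -preimage_bigcup -[X in measurable X]setTI; exact: measurable_tcons.
Qed.

HB.instance Definition _ := isMeasure.Build _ _ _ cons_measure
  cons_measure0 cons_measure_ge0 cons_measure_sigma_additive.

Let cons_measure_sigma_finite : sigma_finite setT cons_measure.
Proof.
have /sigma_finiteP[F [FT ndF Foo]] := sigma_finiteT (@lebesgue_measure R).
have /sigma_finiteP[G [GT ndG Goo]] := sigma_finiteT mu.
exists (fun n => @tuncons d @^-1` (F n `*` G n)).
  rewrite -preimage_bigcup (_ : \bigcup_n (F n `*` G n) = setT) ?preimage_setT//.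
  apply/seteqP; split => // -[x t] _.
  have [n _ Fx] : (\bigcup_n F n) x by rewrite -FT.
  have [m _ Gt] : (\bigcup_n G n) t by rewrite -GT.
  (* Both exhaustions are nondecreasing, so one common index captures the head and the tail. *)
  exists (maxn n m) => //; split.
    by move: x Fx; exact/subsetPset/ndF/leq_maxl.
  by move: t Gt; exact/subsetPset/ndG/leq_maxr.
move=> n; have [mF Fnoo] := Foo n; have [mG Gnoo] := Goo n; split.
  rewrite -[X in measurable X]setTI.
  by apply: measurable_tuncons => //; exact: measurableX.
rewrite /cons_measure /pushforward -comp_preimage.
rewrite (_ : @tuncons d \o @tcons d = id); last by apply/funext => p; exact: tconsK.
by rewrite preimage_id product_measure1E// lte_mul_pinfty// ge0_fin_numE.
Qed.

HB.instance Definition _ := @Measure_isSigmaFinite.Build _ _ _ cons_measure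
  cons_measure_sigma_finite.

End cons_measure.

End boxes.

(** * Iterated Lebesgue measure on tuples and the one-dimensional Gaussian integral *)

Section tuple_integral.
Context {R : realType}.

(** The recursion carries sigma-finiteness along, which the product and Tonelli require at every
    stage. The Dirac mass at the empty tuple gives the 0-dimensional box volume 1, the empty
    product. *)
Fixpoint lebesgue_tuple d : {sigma_finite_measure set (d.-tuple R) -> \bar R} :=
  match d with
  | 0 => \d_([tuple] : 0.-tuple R)
  | d'.+1 => cons_measure (lebesgue_tuple d')
  end.

Lemma lebesgue_tuple_box d (a b : d.-tuple R) :
  (forall i, tnth a i <= tnth b i) ->
  lebesgue_tuple d (box a b) = (\prod_(i < d) (tnth b i - tnth a i))%:E.
Proof.
elim: d a b => [|d IHd] a b ab.
  rewrite big_ord0 /= diracE (_ : (_ \in _) = true)//.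
  by apply/mem_set => -[].
rewrite /= /cons_measure /pushforward.
pose a' := (tuncons a).2; pose b' := (tuncons b).2.
have aE i : tnth a (lift ord0 i) = tnth a' i.
  by rewrite /a' /tuncons /= [in LHS](tuple_eta a) tnthS.
have bE i : tnth b (lift ord0 i) = tnth b' i.
  by rewrite /b' /tuncons /= [in LHS](tuple_eta b) tnthS.
rewrite (_ : _ @^-1` _ = `[thead a, thead b]%classic `*` box a' b'); last first.
  apply/seteqP; split => [[x t] abx|[x t] [/= xab tab] i].
    split => /=; first by rewrite in_itv/=; have := abx ord0.
    by move=> i; have := abx (lift ord0 i); rewrite aE bE /tcons tnthS.
  have [j ->|->] := unliftP ord0 i; last by move: xab; rewrite in_itv.
  by rewrite aE bE /tcons tnthS; exact: tab.
rewrite product_measure1E//; last exact: measurable_box.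
rewrite big_ord_recl EFinM; congr (_ * _)%E.
  rewrite -[LHS]/(lebesgue_measure `[thead a, thead b]%classic).
  (* The interval formula tests for strict inequality, so a side of length zero is treated apart. *)
  rewrite lebesgue_measure_itv/= lte_fin; have := ab ord0.
  by rewrite le_eqVlt => /predU1P[/= E|->//]; rewrite [thead a]E ltxx -E subrr.
rewrite IHd; last by move=> i; rewrite -aE -bE.
by congr (_%:E); apply: eq_bigr => i _; rewrite aE bE.
Qed.

(** Tonelli, with the head as the inner variable: this is the coordinate in which the square will be
    completed. *)
Lemma integral_cons_measure d (mu : {sigma_finite_measure set (d.-tuple R) -> \bar R})
    (f : d.+1.-tuple R -> \bar R) :
  measurable_fun [set: d.+1.-tuple R] f -> (forall x, (0 <= f x)%E) ->
  (\int[cons_measure mu]_x f x =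
   \int[mu]_t \int[@lebesgue_measure R]_y f (tcons (y, t)))%E.
Proof.
move=> mf f0.
etransitivity.
  exact: (ge0_integral_pushforward (@measurable_tcons R d)
    (@lebesgue_measure R \x mu)%E measurableT mf).
rewrite preimage_setT fubini_tonelli2//=.
exact: (measurableT_comp mf (@measurable_tcons R d)).
Qed.

(** The normal density with mean [m] and variance [1 / (2 k)] has total mass one, and its peak is
    the inverse of the claimed value. *)
Lemma integral_gaussian (k m : R) : 0 < k ->
  (\int[@lebesgue_measure R]_x (expR (- k * (x - m) ^+ 2))%:E =
   (Num.sqrt (pi / k))%:E)%E.
Proof.
move=> k0.
pose s := Num.sqrt (k^-1 / 2).
have s2 : s ^+ 2 *+ 2 = k^-1.
  by rewrite sqr_sqrtr ?divr_ge0 ?invr_ge0 ?ltW// -mulr_natr divfK.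
have s0 : s != 0 by rewrite sqrtr_eq0 -ltNge divr_gt0 ?invr_gt0.
have c0 : 0 < Num.sqrt (pi / k) by rewrite sqrtr_gt0 divr_gt0 ?pi_gt0.
have peakE : normal_peak s = (Num.sqrt (pi / k))^-1.
  by rewrite /normal_peak mulrC -mulrnAr s2.
have : (\int[@lebesgue_measure R]_x
    ((Num.sqrt (pi / k))^-1%:E * (expR (- k * (x - m) ^+ 2))%:E) = 1)%E.
  rewrite -[RHS](integral_normal_pdf m s) normal_pdfE//.
  apply: eq_integral => x _.
  by rewrite -EFinM peakE /normal_fun s2 invrK mulNr mulNr [_ * k]mulrC.
rewrite ge0_integralZl_EFin//=; last first.
  apply/measurable_EFinP; apply: measurableT_comp => //.
  by apply: measurable_funM => //; apply: measurable_funX; exact: measurable_funB.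
move=> /(congr1 (fun z => (Num.sqrt (pi / k))%:E * z)%E).
by rewrite muleA -EFinM divff ?gt_eqF// mul1e mule1.
Qed.

End tuple_integral.

(** * Positive definite matrices and Schur complements *)

Section posdef.
Context {R : realType}.

Definition posdef d (G : 'M[R]_d) :=
  G^T = G /\ forall x : 'cV[R]_d, x != 0 -> 0 < qform G x.

Lemma qformD d (G : 'M[R]_d) (x y : 'cV[R]_d) : G^T = G ->
  qform G (x + y) = qform G x + 2 * (y^T *m G *m x) 0 0 + qform G y.
Proof.
move=> GT; have xy : (x^T *m G *m y) 0 0 = (y^T *m G *m x) 0 0.
  rewrite -[in RHS](trmxK (y^T *m G *m x)) [in RHS]mxE.
  by rewrite !trmx_mul trmxK GT mulmxA.
have addE (A B : 'M[R]_1) : (A + B) 0 0 = A 0 0 + B 0 0 by rewrite mxE.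
rewrite /qform [(x + y)^T]raddfD !mulmxDl !mulmxDr !addE xy; ring.
Qed.

Lemma qformZ d (G : 'M[R]_d) (a : R) (x : 'cV[R]_d) :
  qform G (a *: x) = a ^+ 2 * qform G x.
Proof.
by rewrite /qform [(a *: x)^T]linearZ/= -!scalemxAl -scalemxAr 2!mxE mulrA expr2.
Qed.

(* If x^T S x = 0 then, for all y, t |-> (x + t y)^T S (x + t y) is a
   nonnegative affine-plus-quadratic function vanishing at 0, whence
   y^T S x = 0; so S x = 0. *)
Lemma psd_unit_posdef d (S : 'M[R]_d) : S^T = S ->
  (forall x : 'cV[R]_d, 0 <= qform S x) -> S \in unitmx -> posdef S.
Proof.
move=> ST S0 Su; split => // x x0; rewrite lt_neqAle S0 andbT eq_sym.
apply: contraNneq x0 => Sx0.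
suff : S *m x = 0 by move=> /(congr1 (mulmx (invmx S))); rewrite mulKmx ?mulmx0// => ->.
have yx (y : 'cV[R]_d) : (y^T *m S *m x) 0 0 = 0.
  set b := (_ *m x) 0 0.
  have h t : 0 <= 2 * t * b + t ^+ 2 * qform S y.
    have := S0 (x + t *: y); rewrite qformD// Sx0 qformZ.
    rewrite [(t *: y)^T]linearZ/= -!scalemxAl mxE -/b add0r.
    by rewrite mulrA.
  have := S0 y; set q := qform S y in h *; move=> q0.
  (* The minimiser would be [- b / q]; adding 1 keeps the denominator positive when [q] vanishes,
     and the value is still a negative multiple of [b ^+ 2]. *)
  have := h (- b / (q + 1)).
  have q1 : q + 1 != 0 by rewrite gt_eqF// ltr_wpDl.
  have -> : 2 * (- b / (q + 1)) * b + (- b / (q + 1)) ^+ 2 * q =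
     - (b / (q + 1)) ^+ 2 * (q + 2) by field.
  rewrite mulNr oppr_ge0 pmulr_lle0 ?ltr_wpDl//.
  have := sqr_ge0 (b / (q + 1)); move=> ? ?.
  have /eqP : (b / (q + 1)) ^+ 2 = 0 by apply/eqP; rewrite eq_le; apply/andP.
  by rewrite sqrf_eq0 mulf_eq0 invr_eq0 (negPf q1) orbF => /eqP.
apply/matrixP => i j; rewrite (ord1 j) [RHS]mxE.
have := yx (delta_mx i 0).
by rewrite -mulmxA trmx_delta -rowE mxE.
Qed.

(** The inverse form at [x] equals the form of [S] at [invmx S *m x]. *)
Lemma posdef_inv d (S : 'M[R]_d) : S \in unitmx -> posdef S -> posdef (invmx S).
Proof.
move=> Su [ST S0]; split; first by rewrite trmx_inv ST.
move=> x x0; have y0 : invmx S *m x != 0.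
  by apply: contraNneq x0 => /(congr1 (mulmx S)); rewrite mulKVmx// mulmx0 => ->.
have := S0 _ y0.
by rewrite /qform trmx_mul trmx_inv ST -!mulmxA mulKVmx.
Qed.

Section schur.
Variables (d : nat) (G : 'M[R]_(1 + d)).
Let a := G 0 0.
Let b : 'rV[R]_d := ursubmx G.
Definition schur : 'M[R]_d := drsubmx G - a^-1 *: (b^T *m b).

Hypothesis Gpd : posdef G.

Let GE : G = block_mx a%:M b b^T (drsubmx G).
Proof.
rewrite -[LHS]submxK; congr block_mx.
  rewrite [LHS]mx11_scalar /ulsubmx !mxE; congr (G _ _)%:M; exact: val_inj.
by rewrite /b -[in LHS]Gpd.1 -trmx_ursub.
Qed.

Lemma posdef_diag_gt0 : 0 < a.
Proof.
have := Gpd.2 (delta_mx 0 0); rewrite /qform trmx_delta -rowE -colE !mxE; apply.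
by apply/eqP => /matrixP /(_ 0 0); rewrite !mxE/= => /eqP; rewrite oner_eq0.
Qed.

Lemma schur_tr : schur^T = schur.
Proof.
by rewrite /schur linearB/= linearZ/= trmx_mul trmxK trmx_drsub Gpd.1.
Qed.

(** Completion of the square in the first coordinate [x]; the remainder depends on [y] alone. *)
Lemma qform_schur (x : R) (y : 'cV[R]_d) :
  qform G (col_mx x%:M y) = a * (x + a^-1 * (b *m y) 0 0) ^+ 2 + qform schur y.
Proof.
have a0 : a != 0 by rewrite gt_eqF// posdef_diag_gt0.
rewrite /qform {1}GE tr_col_mx mul_row_block mul_row_col tr_scalar_mx.
rewrite !mulmxDl -!mulmxA !mul_scalar_mx.
rewrite /schur mulmxBl mulmxBr -scalemxAl -scalemxAr -!mulmxA.
set z := b *m y.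
have -> : y^T *m (b^T *m x%:M) = x *: (z)^T.
  by rewrite mul_mx_scalar -scalemxAr -trmx_mul.
have -> : y^T *m (b^T *m z) = ((z 0 0) ^+ 2)%:M.
  rewrite mulmxA -trmx_mul -/z [z in z^T]mx11_scalar [z in _ *m z]mx11_scalar.
  by rewrite tr_scalar_mx -scalar_mxM expr2.
rewrite !mxE/= ?mulr1n.
by field.
Qed.

Lemma posdef_schur : posdef schur.
Proof.
split; first exact: schur_tr.
(* This first coordinate makes the completed square vanish, leaving the form of the Schur
   complement. *)
move=> y y0; have := Gpd.2 (col_mx (- (a^-1 * (b *m y) 0 0))%:M y).
rewrite qform_schur addNr expr0n mulr0 add0r; apply.
apply: contraNneq y0 => /(congr1 dsubmx); rewrite col_mxKd => ->.
by rewrite linear0.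
Qed.

Lemma det_schur : \det G = a * \det schur.
Proof.
have a0 : a != 0 by rewrite gt_eqF// posdef_diag_gt0.
(* Block elimination: a unit lower triangular factor times an upper triangular one. *)
have -> : G = block_mx 1%:M 0 (a^-1 *: b^T) 1%:M *m block_mx a%:M b 0 schur.
  rewrite mulmx_block !mul1mx !mul0mx !addr0 [LHS]GE; congr block_mx.
    by rewrite mul_mx_scalar scalerA divff// scale1r.
  by rewrite /schur -scalemxAl addrC subrK.
by rewrite det_mulmx det_lblock det_ublock !det1 !mul1r det_scalar1.
Qed.

End schur.

Lemma posdef_det_gt0 d (G : 'M[R]_d) : posdef G -> 0 < \det G.
Proof.
elim: d G => [|d IHd] G Gpd; first by rewrite det_mx00.
rewrite (det_schur Gpd) mulr_gt0// ?posdef_diag_gt0//.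
by apply: IHd; exact: posdef_schur.
Qed.

End posdef.

(** * The Gaussian integral with a positive definite matrix *)

Section gaussian.
Context {R : realType}.

Lemma measurable_fun_vec_coord d (m : 'cV[R]_d) i j :
  measurable_fun [set: d.-tuple R] (fun x => (vec x - m) i j).
Proof.
rewrite (_ : (fun _ => _) = fun x => tnth x i - m i j).
  by apply: measurable_funB => //; exact: measurable_tnth.
by apply/funext => x; rewrite !mxE.
Qed.

Lemma qform_sum d (G : 'M[R]_d) (x : 'cV[R]_d) :
  qform G x = \sum_i \sum_j x j 0 * G j i * x i 0.
Proof.
rewrite /qform mxE; apply: eq_bigr => i _.
by rewrite mxE big_distrl/=; apply: eq_bigr => j _; rewrite mxE.
Qed.

Lemma measurable_fun_qform d (G : 'M[R]_d) (m : 'cV[R]_d) :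
  measurable_fun [set: d.-tuple R] (fun x => qform G (vec x - m)).
Proof.
under eq_fun do rewrite qform_sum.
apply: measurable_sum => i; apply: measurable_sum => j.
apply: measurable_funM; last exact: measurable_fun_vec_coord.
by apply: measurable_funM => //; exact: measurable_fun_vec_coord.
Qed.

Lemma measurable_fun_gaussian d (c : R) (G : 'M[R]_d) (m : 'cV[R]_d) :
  measurable_fun [set: d.-tuple R]
    (fun x => (expR (- c * qform G (vec x - m)))%:E).
Proof.
apply/measurable_EFinP; apply: measurableT_comp => //.
by apply: measurable_funM => //; exact: measurable_fun_qform.
Qed.

Lemma vec_tcons d (y : R) (t : d.-tuple R) :
  vec (tcons (y, t)) = col_mx y%:M (vec t) :> 'cV[R]_(1 + d).
Proof.
apply/matrixP => i j; rewrite (ord1 j) !mxE; case: splitP => k ik.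
  rewrite (ord1 k) mxE eqxx mulr1n /tcons (_ : i = ord0)//.
  by apply/val_inj; rewrite /= ik (ord1 k).
rewrite mxE /tcons (_ : i = lift ord0 k) ?tnthS//.
by apply/val_inj; rewrite /= ik.
Qed.

Lemma integral_lebesgue_tuple_gaussian d (c : R) (G : 'M[R]_d) (m : 'cV[R]_d) :
  0 < c -> posdef G ->
  (\int[lebesgue_tuple d]_x (expR (- c * qform G (vec x - m)))%:E =
   ((pi / c) `^ (d%:R / 2) / Num.sqrt (\det G))%:E)%E.
Proof.
move=> c0; elim: d G m => [|d IHd] G m Gpd.
  (* In dimension 0 the form is an empty sum and the determinant is 1, so both sides equal 1. *)
  rewrite det_mx00 sqrtr1 mul0r powRr0 divr1/=.
  rewrite integral_dirac//=; last exact: measurable_fun_gaussian.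
  by rewrite diracT mul1e qform_sum big_ord0 mulr0 expR0.
have a0 := posdef_diag_gt0 Gpd.
set a : R := G 0 0 in a0.
set S := schur (G : 'M[R]_(1 + d)).
pose m0 := usubmx (m : 'cV[R]_(1 + d)); pose m1 := dsubmx (m : 'cV[R]_(1 + d)).
(* For a fixed tail [t], [s t] is the centre of the Gaussian in the head, where the completed square
   is zero. *)
pose s (t : d.-tuple R) := m0 0 0 -
  a^-1 * (ursubmx (G : 'M[R]_(1 + d)) *m (vec t - m1)) 0 0.
have qE (y : R) (t : d.-tuple R) : qform G (vec (tcons (y, t)) - m) =
    a * (y - s t) ^+ 2 + qform S (vec t - m1).
  have -> : vec (tcons (y, t)) - m =
      col_mx (y - m0 0 0)%:M (vec t - m1) :> 'cV[R]_(1 + d).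
    rewrite vec_tcons raddfB/= -mx11_scalar -[vec t - m1]/(vec t + - m1).
    by rewrite -add_col_mx -opp_col_mx vsubmxK.
  rewrite (qform_schur Gpd); congr (_ * _ ^+ 2 + _).
  by rewrite /s opprB addrCA addrC addrAC.
rewrite /= integral_cons_measure; [|exact: measurable_fun_gaussian|
  by move=> x; rewrite lee_fin expR_ge0].
have ca0 : 0 < c * a by rewrite mulr_gt0.
rewrite (eq_integral (fun t => (Num.sqrt (pi / (c * a)))%:E *
    (expR (- c * qform S (vec t - m1)))%:E)%E); last first.
  move=> t _; rewrite -(integral_gaussian (s t) ca0) muleC.
  rewrite -ge0_integralZl_EFin//=; last first.
    apply/measurable_EFinP; apply: measurableT_comp => //.
    by apply: measurable_funM => //; apply: measurable_funX; exact: measurable_funB.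
  apply: eq_integral => y _; rewrite -EFinM -expRD qE; congr (expR _)%:E; ring.
rewrite ge0_integralZl_EFin//=; [|exact: measurable_fun_gaussian].
rewrite (IHd _ _ (posdef_schur Gpd)) -EFinM; congr (_%:E).
have pc0 : 0 < pi / c by rewrite divr_gt0 ?pi_gt0.
have -> : pi / (c * a) = pi / c * a^-1 by rewrite invfM mulrA.
have -> : (pi / c) `^ (d.+1%:R / 2) =
    (pi / c) `^ (d%:R / 2) * Num.sqrt (pi / c).
  rewrite -(powR12_sqrt (ltW pc0)) -powRD; last by rewrite (gt_eqF pc0) implybT.
  by congr (_ `^ _); rewrite -natr1 mulrDl mul1r.
have sa0 : Num.sqrt a != 0 by rewrite gt_eqF// sqrtr_gt0.
have sS0 : Num.sqrt (\det S) != 0.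
  by rewrite gt_eqF// sqrtr_gt0 posdef_det_gt0//; exact: posdef_schur.
rewrite (det_schur Gpd) -/a -/S (sqrtrM _ (ltW pc0)) (sqrtrM _ (ltW a0)).
rewrite sqrtrV ?(ltW a0)//.
by field; apply/andP.
Qed.

End gaussian.

(** * Comparison of integrals of nonnegative functions *)

Section integral_monotonicity.
Local Open Scope ereal_scope.
Context d (T : measurableType d) (R : realType) (mu : {measure set T -> \bar R}).
Implicit Types f g : T -> \bar R.

(* No measurability is required, the integral of a nonnegative function being
   the supremum of the integrals of the simple functions below it. *)
Lemma ge0_le_integralT f g : (forall x, 0 <= f x) -> (forall x, f x <= g x) ->
  \int[mu]_x f x <= \int[mu]_x g x.
Proof.
move=> f0 fg; have g0 x : 0 <= g x := le_trans (f0 x) (fg x).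
rewrite !ge0_integralTE//; apply: le_ereal_sup => _ /= [h hf <-].
by exists h => // x; exact: le_trans (hf x) (fg x).
Qed.

(** Measurability of [f] allows the exceptional null set to be removed from its integral. The
    extension of [f] by zero is then below [g] everywhere. *)
Lemma ae_ge0_le_integralT f g :
  measurable_fun setT f -> (forall x, 0 <= f x) -> (forall x, 0 <= g x) ->
  {ae mu, forall x, f x <= g x} -> \int[mu]_x f x <= \int[mu]_x g x.
Proof.
move=> mf f0 g0 [N [mN N0 fgN]].
rewrite (ge0_negligible_integral mN)// integral_mkcond.
apply: ge0_le_integralT => x; rewrite patchE; case: ifPn => //.
rewrite inE => -[_ Nx]; apply: contrapT => fgx; exact/Nx/fgN.
Qed.

End integral_monotonicity.

(** * Positive definiteness of the covariance and of its inverse *)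

Section covariance.
Context {R : realType} (d : nat) (leb : {measure set (d.-tuple R) -> \bar R}).
Variable k : d.-tuple R -> R.
Hypothesis k0 : forall v, 0 <= k v.
Hypothesis k_cov : forall i j : 'I_d, leb.-integrable setT (fun v =>
  ((tnth v i - kmean leb k i 0) * (tnth v j - kmean leb k j 0) * k v)%:E).

Lemma kcov_tr : (kcov leb k)^T = kcov leb k.
Proof.
apply/matrixP => i j; rewrite !mxE; congr Rintegral.
by apply/funext => v; rewrite [X in X * _]mulrC.
Qed.

(** The form at [x] is the variance of the linear functional [x], the integral of a square against
    [k]. Integrability of each entry justifies exchanging sums and integral. *)
Lemma kcov_psd (x : 'cV[R]_d) : 0 <= qform (kcov leb k) x.
Proof.
pose m := kmean leb k.
have int_ij i j : leb.-integrable setT (fun v =>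
    (x j 0 * x i 0 * ((tnth v j - m j 0) * (tnth v i - m i 0) * k v))%:E).
  by have := integrableZl measurableT (x j 0 * x i 0) (k_cov j i).
have int_i i : leb.-integrable setT (fun v =>
    (\sum_j (x j 0 * x i 0 * ((tnth v j - m j 0) * (tnth v i - m i 0) * k v))%:E)%E).
  exact: integrable_sum.
suff -> : qform (kcov leb k) x =
    Rintegral leb setT (fun v => (\sum_i x i 0 * (tnth v i - m i 0)) ^+ 2 * k v).
  by apply: Rintegral_ge0 => v _; rewrite mulr_ge0 ?sqr_ge0.
rewrite qform_sum /Rintegral.
rewrite (_ : (fun v => _) = (fun v => \sum_i \sum_j
    (x j 0 * x i 0 * ((tnth v j - m j 0) * (tnth v i - m i 0) * k v))%:E)%E); last first.
  apply/funext => v; rewrite expr2 mulr_suml mulr_suml -sumEFin.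
  apply: eq_bigr => i _; rewrite mulr_sumr mulr_suml -sumEFin.
  by apply: eq_bigr => j _; congr (_%:E); ring.
rewrite integral_sum// -sum_fine; last first.
  by move=> i _; exact: integrable_fin_num.
apply: eq_bigr => i _; rewrite integral_sum// -sum_fine; last first.
  by move=> j _; exact: integrable_fin_num.
apply: eq_bigr => j _; rewrite mxE mulrAC -RintegralZl//.
exact: k_cov.
Qed.

Lemma kcov_posdef : kcov leb k \in unitmx -> posdef (kcov leb k).
Proof. by apply: psd_unit_posdef; [exact: kcov_tr|exact: kcov_psd]. Qed.

Lemma kprec_posdef : kcov leb k \in unitmx -> posdef (kprec leb k).
Proof. by move=> ku; apply: posdef_inv => //; exact: kcov_posdef. Qed.

End covariance.

(** * Bounds on the integrated squared kernel and its expectation *)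

Section energy.
Context {R : realType} (d : nat) (leb : {measure set (d.-tuple R) -> \bar R}).
Hypothesis leb_box : forall a b : d.-tuple R,
  (forall i, tnth a i <= tnth b i) ->
  leb (box a b) = (\prod_(i < d) (tnth b i - tnth a i))%:E.

Lemma box_measureE A : measurable A -> leb A = lebesgue_tuple d A.
Proof.
by apply: box_measure_unique => // a b; exact: lebesgue_tuple_box.
Qed.

(** Squaring the envelope produces [\det G] and doubles the rate [c]; the Gaussian integral divides
    by the square root of [\det G], so one square root remains. *)
Lemma integral_sqr_le_gaussian (k : d.-tuple R -> R) (G : 'M[R]_d)
    (m : 'cV[R]_d) (c C : R) :
  measurable_fun setT k -> (forall y, 0 <= k y) -> 0 < c -> posdef G ->
  (forall y, k y <= C * Num.sqrt (\det G) * expR (- c * qform G (vec y - m))) ->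
  (\int[leb]_y ((k y) ^+ 2)%:E <=
   (C ^+ 2 * (pi / (2 * c)) `^ (d%:R / 2) * Num.sqrt (\det G))%:E)%E.
Proof.
move=> mk k0 c0 Gpd kG.
have dG := posdef_det_gt0 Gpd.
have c20 : 0 < 2 * c by rewrite mulr_gt0.
apply: (@le_trans _ _ (\int[leb]_y ((C ^+ 2 * \det G)%:E *
    (expR (- (2 * c) * qform G (vec y - m)))%:E)))%E.
  apply: ge0_le_integralT => y; first by rewrite lee_fin sqr_ge0.
  rewrite -EFinM lee_fin.
  apply: (@le_trans _ _ ((C * Num.sqrt (\det G) *
      expR (- c * qform G (vec y - m))) ^+ 2)).
    by rewrite ler_sqr ?nnegrE// (le_trans (k0 y)).
  rewrite !exprMn sqr_sqrtr ?(ltW dG)// -expRM_natl.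
  by rewrite (_ : 2%:R * (- c * _) = - (2 * c) * qform G (vec y - m))//; ring.
rewrite ge0_integralZl_EFin//=; last 2 first.
- exact: measurable_fun_gaussian.
- by rewrite mulr_ge0 ?sqr_ge0 ?ltW.
rewrite (eq_measure_integral (lebesgue_tuple d)) => [|A mA _]; last first.
  exact: box_measureE.
rewrite integral_lebesgue_tuple_gaussian// -EFinM lee_fin.
have s0 : Num.sqrt (\det G) != 0 by rewrite gt_eqF// sqrtr_gt0.
have dE : \det G = Num.sqrt (\det G) ^+ 2 by rewrite sqr_sqrtr// ltW.
by rewrite [X in _ * X * _ <= _]dE le_eqVlt; apply/orP; left; apply/eqP; field.
Qed.

Section energy_fun.
Variable k : d.-tuple R -> d.-tuple R -> R.
Hypothesis mk : measurable_fun setT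
  (fun p : d.-tuple R * d.-tuple R => k p.1 p.2).

Lemma measurable_kernel_section u : measurable_fun setT (k u).
Proof. exact: (measurable_fun_pair2 u mk). Qed.

(** Tonelli needs a sigma-finite measure, so it is applied to [lebesgue_tuple d] and transferred to
    [leb], which agrees with it on measurable sets. *)
Lemma measurable_fun_energy :
  measurable_fun setT (fun u => \int[leb]_y ((k u y) ^+ 2)%:E)%E.
Proof.
rewrite (_ : (fun u => _) =
    fubini_F (lebesgue_tuple d) (fun p => ((k p.1 p.2) ^+ 2)%:E)).
  apply: measurable_fun_fubini_tonelli_F => [|p]; last by rewrite lee_fin sqr_ge0.
  by apply/measurable_EFinP; exact: measurable_funX.
apply/funext => u; apply: eq_measure_integral => A mA _; exact: box_measureE.
Qed.

Lemma Hh_ge0 (P : probability (d.-tuple R) R) Y : (0 <= Hh leb P k Y)%E.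
Proof.
by apply: integral_ge0 => u _; apply: integral_ge0 => y _; rewrite lee_fin sqr_ge0.
Qed.

Lemma Hh_leT (P : probability (d.-tuple R) R) Y : measurable Y ->
  (Hh leb P k Y <= Hh leb P k setT)%E.
Proof.
move=> mY; apply: ge0_le_integralT => u.
  by apply: integral_ge0 => y _; rewrite lee_fin sqr_ge0.
apply: ge0_subset_integral => //.
- apply/measurable_EFinP; apply: measurable_funX; exact: measurable_kernel_section.
- by move=> y _; rewrite lee_fin sqr_ge0.
Qed.

(** Since [g] is not known to be measurable, [C] is not pulled out of its integral. Its inverse is
    moved inside the integral of the energy instead, and that integrand is measurable. *)
Lemma Hh_le (P : probability (d.-tuple R) R) (g : d.-tuple R -> R) (C : R) :
  0 < C -> (forall u, 0 <= g u) ->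
  {ae P, forall u, \int[leb]_y ((k u y) ^+ 2)%:E <= (C * g u)%:E}%E ->
  (Hh leb P k setT <= C%:E * \int[P]_u (g u)%:E)%E.
Proof.
move=> C0 g0 kg.
rewrite -[leLHS]mul1e -(divff (lt0r_neq0 C0)) EFinM -muleA lee_pmul2l//.
rewrite -ge0_integralZl_EFin ?invr_ge0 ?(ltW C0)//; last 2 first.
- by move=> u _; apply: integral_ge0 => y _; rewrite lee_fin sqr_ge0.
- exact: measurable_fun_energy.
apply: ae_ge0_le_integralT.
- apply: measurable_funeM; exact: measurable_fun_energy.
- move=> u; rewrite mule_ge0 ?lee_fin ?invr_ge0 ?(ltW C0)//.
  by apply: integral_ge0 => y _; rewrite lee_fin sqr_ge0.
- by move=> u; rewrite lee_fin.
- apply: filterS kg => u kgu.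
  rewrite -[leRHS]mul1e -(mulVf (lt0r_neq0 C0)) EFinM -muleA.
  by rewrite lee_pmul2l ?lte_fin ?invr_gt0.
Qed.

Lemma Hh_ge (P : probability (d.-tuple R) R) (c : R) : 0 <= c ->
  {ae P, forall u, c%:E <= \int[leb]_y ((k u y) ^+ 2)%:E}%E ->
  (c%:E <= Hh leb P k setT)%E.
Proof.
move=> c0 ck; rewrite -[c%:E]mule1 -(probability_setT P) -integral_cst//.
apply: ae_ge0_le_integralT => //.
by move=> u; apply: integral_ge0 => y _; rewrite lee_fin sqr_ge0.
Qed.

End energy_fun.

End energy.

(** * From bounds on the energy to bounds on the effective dimension *)

Section effective_dimension.
Context {R : realType} (d : nat) (leb : {measure set (d.-tuple R) -> \bar R}).
Variables (P : probability (d.-tuple R) R) (k : d.-tuple R -> d.-tuple R -> R).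

(** For [r] nonnegative the power of [h] is at least 1, so the truncation at 1 can be absorbed into
    the constant as [Num.max K 1]. *)
Lemma deff_le (h r K : R) (Y : set (d.-tuple R)) : 0 < h < 1 -> 0 <= r ->
  (Hh leb P k Y <= (K * h `^ (- r))%:E)%E ->
  (deff leb P k h Y <= (r + ln (Num.max K 1) / ln (1 / h))%:E)%E.
Proof.
move=> /andP[h0 h1] r0; have := Hh_ge0 leb k P Y.
rewrite /deff; case: Hh => [x| |]//; rewrite !lee_fin => x0 xK.
have Lh : 0 < ln (1 / h) by rewrite ln_gt0// div1r invf_gt1.
have hr1 : 1 <= h `^ (- r).
  by rewrite powRN -(invr1) lef_pV2 ?posrE ?powR_gt0// -(powRr0 h) ger_powR// h0 ltW.
have M1 : 0 < Num.max K 1 by rewrite lt_max ltr01 orbT.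
rewrite ler_pdivrMr// mulrDl divfK ?gt_eqF//.
have -> : r * ln (1 / h) = ln (h `^ (- r)).
  by rewrite ln_powR div1r lnV ?posrE// mulrN mulNr.
rewrite addrC -lnM ?posrE ?powR_gt0// ler_ln ?posrE ?mulr_gt0 ?powR_gt0//; last first.
  by rewrite lt_max ltr01 orbT.
rewrite ge_max; apply/andP; split.
  by rewrite (le_trans xK)// ler_wpM2r ?powR_ge0// le_max lexx.
by rewrite -[leLHS]mulr1 ler_pM// le_max lexx orbT.
Qed.

(** Truncation at 1 only increases the energy, and an infinite energy gives an infinite [deff]. *)
Lemma deff_ge (h r K : R) (Y : set (d.-tuple R)) : 0 < h < 1 -> 0 < K ->
  ((K * h `^ (- r))%:E <= Hh leb P k Y)%E ->
  ((r + ln K / ln (1 / h))%:E <= deff leb P k h Y)%E.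
Proof.
move=> /andP[h0 h1] K0; rewrite /deff.
case: Hh => [x| |]//; rewrite ?leey// !lee_fin => xK.
have Lh : 0 < ln (1 / h) by rewrite ln_gt0// div1r invf_gt1.
rewrite ler_pdivlMr// mulrDl divfK ?gt_eqF//.
have -> : r * ln (1 / h) = ln (h `^ (- r)).
  by rewrite ln_powR div1r lnV ?posrE// mulrN mulNr.
rewrite addrC -lnM ?posrE ?powR_gt0// ler_ln ?posrE ?mulr_gt0 ?powR_gt0//; last first.
  by rewrite lt_max ltr01 orbT.
by rewrite le_max xK.
Qed.

End effective_dimension.

(** * Limits as the bandwidth tends to zero, in epsilon-delta form *)

Section asymptotics.
Context {R : realType}.

Lemma near0_div_ln (B e : R) : 0 < e -> exists2 del, 0 < del &
  forall h, 0 < h < del -> h < 1 /\ `|B / ln (1 / h)| <= e.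
Proof.
move=> e0; exists (expR (- (`|B| / e))) => [|h /andP[h0 hdel]].
  exact: expR_gt0.
have h1 : h < 1.
  rewrite (lt_le_trans hdel)// -expR0 ler_expR oppr_le0.
  by rewrite divr_ge0// ltW.
have Lh : 0 < ln (1 / h) by rewrite ln_gt0// div1r invf_gt1.
split => //; rewrite normrM normfV (gtr0_norm Lh) ler_pdivrMr//.
rewrite mulrC -ler_pdivrMr// div1r lnV ?posrE// lerNr -[leRHS]expRK.
by rewrite ler_ln ?posrE ?expR_gt0// ltW.
Qed.

(** Half of the tolerance [e] pays for [r h] exceeding [rs], the other half for the logarithmic
    remainder. *)
Lemma deff_le_eventually d (leb : {measure set (d.-tuple R) -> \bar R})
    (P : probability (d.-tuple R) R) (k : R -> d.-tuple R -> d.-tuple R -> R)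
    (Y : set (d.-tuple R)) (hr K rs : R) (r : R -> R) : 0 < hr ->
  (forall h, 0 < h <= hr -> 0 <= r h) ->
  (forall h, 0 < h <= hr -> (Hh leb P (k h) Y <= (K * h `^ (- r h))%:E)%E) ->
  (forall e, 0 < e -> exists2 del, 0 < del & forall h, 0 < h < del -> r h <= rs + e) ->
  forall e, 0 < e -> exists2 del, 0 < del &
    forall h, 0 < h < del -> (deff leb P (k h) h Y <= (rs + e)%:E)%E.
Proof.
move=> hr0 r0 HK rrs e e0; have e20 : 0 < e / 2 by rewrite divr_gt0.
have [d1 d10 rd1] := rrs _ e20.
have [d2 d20 Kd2] := near0_div_ln (ln (Num.max K 1)) e20.
exists (Num.min hr (Num.min d1 d2)) => [|h]; first by rewrite !lt_min hr0 d10.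
rewrite !lt_min => /and4P[h0 hhr hd1 hd2].
have hhr' : 0 < h <= hr by rewrite h0 ltW.
have [h1 Kle] := Kd2 h ltac:(by rewrite h0).
apply: (le_trans (deff_le _ (r0 _ hhr') (HK _ hhr'))); first by rewrite h0.
rewrite lee_fin [e]splitr addrA lerD ?rd1 ?h0//.
exact: le_trans (ler_norm _) Kle.
Qed.

Lemma deff_ge_eventually d (leb : {measure set (d.-tuple R) -> \bar R})
    (P : probability (d.-tuple R) R) (k : R -> d.-tuple R -> d.-tuple R -> R)
    (Y : set (d.-tuple R)) (hr K rs : R) : 0 < hr -> 0 < K ->
  (forall h, 0 < h <= hr -> ((K * h `^ (- rs))%:E <= Hh leb P (k h) Y)%E) ->
  forall e, 0 < e -> exists2 del, 0 < del &
    forall h, 0 < h < del -> ((rs - e)%:E <= deff leb P (k h) h Y)%E.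
Proof.
move=> hr0 K0 HK e e0.
have [d2 d20 Kd2] := near0_div_ln (ln K) e0.
exists (Num.min hr d2) => [|h]; first by rewrite !lt_min hr0.
rewrite !lt_min => /and3P[h0 hhr hd2].
have [h1 Kle] := Kd2 h ltac:(by rewrite h0).
apply: le_trans (deff_ge _ K0 (HK h _)); rewrite ?h0 ?(ltW hhr)//.
by rewrite lee_fin lerD2l; move: Kle; rewrite ler_norml => /andP[].
Qed.

End asymptotics.

(** * Determinants of matrices whose eigenvalues live on two scales *)

Section spectrum.
Context {R : realType}.

(** Both expressions for the characteristic polynomial are evaluated at 0, where they carry the same
    sign [(-1) ^+ d]. *)
Lemma det_char_poly_roots d (A : 'M[R]_d) (lam : 'I_d -> R) :
  char_poly A = \prod_(j < d) ('X - (lam j)%:P) -> \det A = \prod_j lam j.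
Proof.
move=> Alam; have := char_poly_det A.
rewrite -horner_coef0 Alam horner_prod.
under eq_bigr do rewrite hornerXsubC sub0r.
rewrite prodrN card_ord => /(mulfI _) ->//.
by rewrite expf_eq0 oppr_eq0 oner_eq0 andbF.
Qed.

Lemma prod_two_scales (d ds : nat) (c h : R) : (ds <= d)%N ->
  \prod_(j < d) (if (j < ds)%N then c * h ^+ 2 else c) = c ^+ d * (h ^+ ds) ^+ 2.
Proof.
move=> dsd; rewrite (eq_bigr (fun j : 'I_d => c * (if (j < ds)%N then h ^+ 2 else 1))).
  rewrite big_split/= prodr_const card_ord -big_mkcond/=.
  by rewrite -(big_ord_widen _ (fun=> h ^+ 2))// prodr_const card_ord -exprM mulnC exprM.
by move=> j _; case: ifP; rewrite ?mulr1.
Qed.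

Lemma det_two_scales (d ds : nat) (c1 c2 h : R) (A : 'M[R]_d) (lam : 'I_d -> R) :
  (ds <= d)%N -> 0 < c1 -> 0 < h ->
  char_poly A = \prod_(j < d) ('X - (lam j)%:P) ->
  (forall j : 'I_d, if (j < ds)%N then c1 * h ^+ 2 <= lam j <= c2 * h ^+ 2
                    else c1 <= lam j <= c2) ->
  c1 ^+ d * (h ^+ ds) ^+ 2 <= \det A <= c2 ^+ d * (h ^+ ds) ^+ 2.
Proof.
move=> dsd c10 h0 /det_char_poly_roots -> lamc.
rewrite -!prod_two_scales//; apply/andP; split; apply: ler_prod => j _;
  have := lamc j; case: ifP => _ /andP[lam1 lam2]; rewrite ?lam1 ?lam2 ?andbT.
- by rewrite mulr_ge0 ?sqr_ge0// ltW.
- exact: ltW.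
- by rewrite (le_trans _ lam1)// mulr_ge0 ?sqr_ge0// ltW.
- by rewrite (le_trans _ lam1)// ltW.
Qed.

(** Inversion reverses the order: the upper eigenvalue constant [c2] gives the lower bound and [c1]
    the upper one. The two-scale product contains the square of [h ^+ ds], so its root is an exact
    power of [h]. *)
Lemma sqrt_det_inv_two_scales (d ds : nat) (c1 c2 h : R) (A : 'M[R]_d)
    (lam : 'I_d -> R) :
  (ds <= d)%N -> 0 < c1 -> c1 <= c2 -> 0 < h ->
  char_poly A = \prod_(j < d) ('X - (lam j)%:P) ->
  (forall j : 'I_d, if (j < ds)%N then c1 * h ^+ 2 <= lam j <= c2 * h ^+ 2
                    else c1 <= lam j <= c2) ->
  (Num.sqrt (c2 ^+ d))^-1 * h `^ (- ds%:R) <= Num.sqrt (\det (invmx A))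
    <= (Num.sqrt (c1 ^+ d))^-1 * h `^ (- ds%:R).
Proof.
move=> dsd c10 c12 h0 Alam lamc.
have c20 := lt_le_trans c10 c12.
have /andP[d1 d2] := det_two_scales dsd c10 h0 Alam lamc.
have hds : 0 < h ^+ ds by rewrite exprn_gt0.
have b0 c : 0 < c -> 0 < c ^+ d * (h ^+ ds) ^+ 2.
  by move=> c0; rewrite mulr_gt0// exprn_gt0.
have dA := lt_le_trans (b0 _ c10) d1.
have sqrtE c : 0 < c -> (Num.sqrt (c ^+ d))^-1 * h `^ (- ds%:R) =
    (Num.sqrt (c ^+ d * (h ^+ ds) ^+ 2))^-1.
  move=> c0; rewrite powRN powR_mulrn ?(ltW h0)// -invfM; congr _^-1.
  by rewrite sqrtrM ?exprn_ge0 ?(ltW c0)// sqrtr_sqr gtr0_norm.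
rewrite !sqrtE// det_inv sqrtrV ?(ltW dA)//.
by rewrite !lef_pV2 ?posrE ?sqrtr_gt0 ?b0//; apply/andP; split; rewrite ler_wsqrtr.
Qed.

End spectrum.

(** * Assembly of the two parts of the theorem *)

Unset Implicit Arguments.

Theorem theorem3 (R : realType) (d : nat)
  (leb : {measure set (d.-tuple R) -> \bar R})
  (leb_box : forall a b : d.-tuple R, (forall i, tnth a i <= tnth b i) ->
     leb [set x | forall i, tnth a i <= tnth x i <= tnth b i]
       = (\prod_(i < d) (tnth b i - tnth a i))%:E)
  (P : probability (d.-tuple R) R)
  (kappa : R -> d.-tuple R -> d.-tuple R -> R)
  (k_ge0 : forall h u v, 0 < h -> 0 <= kappa h u v)
  (k_meas : forall h, 0 < h ->
     measurable_fun setT (fun p : d.-tuple R * d.-tuple R => kappa h p.1 p.2))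
  (k_dens : forall h u, 0 < h -> (\int[leb]_v (kappa h u v)%:E = 1)%E)
  (k_mean : forall h u (i : 'I_d), 0 < h ->
     leb.-integrable setT (fun v => (tnth v i * kappa h u v)%:E))
  (k_cov : forall h u (i j : 'I_d), 0 < h ->
     leb.-integrable setT (fun v =>
       ((tnth v i - kmean leb (kappa h u) i 0) *
        (tnth v j - kmean leb (kappa h u) j 0) * kappa h u v)%:E))
  (k_inv : forall h u, 0 < h -> kcov leb (kappa h u) \in unitmx)
  (c0 C0 : R) (c0_gt0 : 0 < c0) (C0_gt0 : 0 < C0)
  (gauss : forall h, 0 < h -> {ae P, forall u, forall y,
     kappa h u y <= C0 * Num.sqrt (\det (kprec leb (kappa h u))) *
       expR (- c0 * qform (kprec leb (kappa h u)) (vec y - kmean leb (kappa h u)))}) :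
  let C := C0 ^+ 2 * (pi / (2 * c0)) `^ (d%:R / 2) in
  let H := fun h Y0 => Hh leb P (kappa h) Y0 in
  let de := fun h Y0 => deff leb P (kappa h) h Y0 in
  (* part (a) *)
  (forall (hr : R) (r : R -> R) (Cr : R), 0 < hr ->
     (forall h, 0 < h <= hr -> 0 <= r h) ->
     (forall h, 0 < h <= hr ->
        (\int[P]_u (Num.sqrt (\det (kprec leb (kappa h u))))%:E <= (Cr * h `^ (- r h))%:E)%E) ->
     (forall Y0, measurable Y0 -> forall h, 0 < h <= hr -> h < 1 ->
        [/\ (H h Y0 <= H h setT)%E,
            (H h setT <= (C * Cr * h `^ (- r h))%:E)%E &
            (de h Y0 <= (r h + ln (Num.max (C * Cr) 1) / ln (1 / h))%:E)%E]) /\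
     (forall rs : R,
        (forall e, 0 < e -> exists2 del, 0 < del & forall h, 0 < h < del -> r h <= rs + e) ->
        forall Y0, measurable Y0 ->
        forall e, 0 < e -> exists2 del, 0 < del &
          forall h, 0 < h < del -> (de h Y0 <= (rs + e)%:E)%E)) /\
  (* part (b) *)
  (forall (ds : nat) (c1 c2 h0 : R), (ds <= d)%N -> 0 < c1 -> c1 <= c2 -> 0 < h0 ->
     {ae P, forall u, forall h, 0 < h <= h0 ->
        exists lam : 'I_d -> R,
          char_poly (kcov leb (kappa h u)) = \prod_(j < d) ('X - (lam j)%:P) /\
          (forall j : 'I_d, if (j < ds)%N then c1 * h ^+ 2 <= lam j <= c2 * h ^+ 2
                            else c1 <= lam j <= c2)} ->
     [/\ (forall Y0, measurable Y0 -> forall h, 0 < h -> (H h Y0 <= H h setT)%E),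
         (exists K : R, exists2 h1, 0 < h1 &
            forall h, 0 < h <= h1 -> (H h setT <= (K * (h ^+ ds)^-1)%:E)%E),
         (forall Y0, measurable Y0 ->
            forall e, 0 < e -> exists2 del, 0 < del &
              forall h, 0 < h < del -> (de h Y0 <= (ds%:R + e)%:E)%E) &
         (forall cl h0' : R, 0 < cl -> 0 < h0' ->
            (forall h, 0 < h <= h0' -> {ae P, forall u,
               ((cl * Num.sqrt (\det (kprec leb (kappa h u))))%:E
                  <= \int[leb]_y ((kappa h u y) ^+ 2)%:E)%E}) ->
            forall e, 0 < e -> exists2 del, 0 < del &
              forall h, 0 < h < del ->
                ((ds%:R - e)%:E <= de h setT)%E /\ (de h setT <= (ds%:R + e)%:E)%E)]).
Proof.
move=> C H de.
have C_gt0 : 0 < C.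
  by rewrite mulr_gt0 ?exprn_gt0// powR_gt0// divr_gt0 ?pi_gt0// mulr_gt0.
have H_leT Y h : measurable Y -> 0 < h -> (H h Y <= H h setT)%E.
  by move=> mY h0; apply: Hh_leT => //; exact: k_meas.
have energy_le h : 0 < h -> {ae P, forall u,
    \int[leb]_y ((kappa h u y) ^+ 2)%:E <=
    (C * Num.sqrt (\det (kprec leb (kappa h u))))%:E}%E.
  move=> h0; apply: filterS (gauss h h0) => u gu.
  apply: (integral_sqr_le_gaussian leb_box _ _ c0_gt0 _ gu).
  - by apply: measurable_kernel_section; exact: k_meas.
  - by move=> y; exact: k_ge0.
  - apply: kprec_posdef; last exact: k_inv.
    + by move=> v; exact: k_ge0.
    + by move=> i j; exact: k_cov.
(* From here on only the positivity of [C] and the bound [energy_le] are used. *)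
clearbody C; split.
  move=> hr r Cr hr0 r0 EG.
  have HT_le h : 0 < h <= hr -> (H h setT <= (C * Cr * h `^ (- r h))%:E)%E.
    move=> hhr; have /andP[h0 _] := hhr.
    apply: le_trans (Hh_le leb_box (k_meas h h0) C_gt0 _ (energy_le h h0)) _.
      by move=> u; exact: sqrtr_ge0.
    by rewrite -mulrA EFinM lee_pmul2l// EG.
  have HY_le Y h : measurable Y -> 0 < h <= hr ->
      (H h Y <= (C * Cr * h `^ (- r h))%:E)%E.
    by move=> mY hhr; apply: le_trans (HT_le h hhr); apply: H_leT => //; case/andP: hhr.
  split.
    move=> Y mY h hhr h1; have /andP[h0 _] := hhr; split.
    - exact: H_leT.
    - exact: HT_le.
    - by apply: deff_le; [rewrite h0|exact: r0|exact: HY_le].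
  move=> rs rrs Y mY.
  apply: (deff_le_eventually hr0 r0 _ rrs) => h hhr.
  exact: HY_le.
move=> ds c1 c2 h0 dsd c1_gt0 c12 h0_gt0 spec.
have c2_gt0 := lt_le_trans c1_gt0 c12.
have G_bounds h : 0 < h <= h0 -> {ae P, forall u,
    (Num.sqrt (c2 ^+ d))^-1 * h `^ (- ds%:R)
      <= Num.sqrt (\det (kprec leb (kappa h u)))
      <= (Num.sqrt (c1 ^+ d))^-1 * h `^ (- ds%:R)}.
  move=> hh0; apply: filterS spec => u /(_ h hh0)[lam [charE lamc]].
  have /andP[hgt0 _] := hh0.
  exact: sqrt_det_inv_two_scales charE lamc.
have HT_le h : 0 < h <= h0 ->
    (H h setT <= (C * (Num.sqrt (c1 ^+ d))^-1 * h `^ (- ds%:R))%:E)%E.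
  move=> hh0; have /andP[hgt0 _] := hh0.
  (* The almost sure bound on the root determinant is deterministic, so [Hh_le] applies with a
     constant function, whose integral under [P] is [K]. *)
  pose K := (Num.sqrt (c1 ^+ d))^-1 * h `^ (- ds%:R).
  have intK : (\int[P]_u K%:E = K%:E)%E.
    rewrite [LHS]integral_cst// -[RHS]mule1; congr (_ * _)%E.
    exact: probability_setT.
  apply: (@le_trans _ _ (C%:E * \int[P]_u K%:E)%E).
    apply: (Hh_le (g := fun=> K) leb_box (k_meas h hgt0) C_gt0).
      by move=> u; rewrite mulr_ge0 ?powR_ge0// invr_ge0 sqrtr_ge0.
    apply: filterS2 (energy_le h hgt0) (G_bounds h hh0) => u Fu /andP[_ Gu].
    by apply: le_trans Fu _; rewrite lee_fin ler_wpM2l// ltW.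
  by rewrite intK -EFinM mulrA.
have HY_le Y h : measurable Y -> 0 < h <= h0 ->
    (H h Y <= (C * (Num.sqrt (c1 ^+ d))^-1 * h `^ (- ds%:R))%:E)%E.
  by move=> mY hh0; apply: le_trans (HT_le h hh0); apply: H_leT => //; case/andP: hh0.
have de_le Y : measurable Y -> forall e, 0 < e -> exists2 del, 0 < del &
    forall h, 0 < h < del -> (de h Y <= (ds%:R + e)%:E)%E.
  (* The exponent is the constant [ds], so the limsup condition holds with any threshold; 1 is an
     arbitrary choice. *)
  move=> mY; apply: (deff_le_eventually h0_gt0 (r := fun=> ds%:R)).
  - by [].
  - by move=> h hh0; exact: HY_le.
  - by move=> e e0; exists 1 => // h _; rewrite lerDl ltW.
split.
- by move=> Y mY h hgt0; exact: H_leT.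
- exists (C * (Num.sqrt (c1 ^+ d))^-1), h0 => // h hh0.
  have /andP[hgt0 _] := hh0.
  by rewrite -(powR_mulrn ds (ltW hgt0)) -powRN; exact: HT_le.
- exact: de_le.
- move=> cl h0' cl0 h0'0 lower.
  (* The assumed lower bound on the energy is combined with the lower half of [G_bounds]. *)
  pose K := cl * (Num.sqrt (c2 ^+ d))^-1.
  have K0 : 0 < K by rewrite mulr_gt0// invr_gt0 sqrtr_gt0 exprn_gt0.
  have m0 : 0 < Num.min h0 h0' by rewrite lt_min h0_gt0.
  have HT_ge h : 0 < h <= Num.min h0 h0' ->
      ((K * h `^ (- ds%:R))%:E <= H h setT)%E.
    rewrite le_min => /and3P[hgt0 hh0 hh0'].
    apply: Hh_ge.
      by rewrite mulr_ge0 ?powR_ge0// ltW.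
    have := G_bounds h; rewrite hgt0 hh0 => /(_ isT) Gb.
    have := lower h; rewrite hgt0 hh0' => /(_ isT) low.
    apply: filterS2 low Gb => u Fu /andP[Gu _].
    by apply: le_trans Fu; rewrite lee_fin -mulrA ler_wpM2l// ltW.
  move=> e e0.
  have [d1 d10 le1] := de_le setT measurableT e e0.
  have [d2 d20 ge2] := deff_ge_eventually m0 K0 HT_ge e0.
  exists (Num.min d1 d2) => [|h]; first by rewrite lt_min d10.
  rewrite lt_min => /and3P[hgt0 hd1 hd2].
  by split; [apply: ge2|apply: le1]; rewrite hgt0.
Qed.
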